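(* Let $(X,\tau)$ be a Hausdorff, locally compact topological space. Then $(X,{}^{*}O(X))$ is locally compact.
   Context: For a topological space $(X,\tau)$, a set $U\subseteq X$ is called regular open if $\mathrm{int}(\mathrm{cl}(U))=U$; the collection of all regular open subsets is denoted $R.O(X)$. A set $A\subseteq X$ is called $*$-open if for every $x\in A$ there exists $U\in R.O(X)$ with $x\in U\subseteq A$. The collection of all $*$-open subsets of $(X,\tau)$ is denoted ${}^{*}O(X)$; it is a topology on $X$. A space is locally compact if for every point $x$ there are an open set $U$ containing $x$ and a compact set $C$ with $U\subseteq C$. *)

(* Defs.v *)
From HB Require Import structures.
From mathcomp Require Import all_boot all_classical topology.

Set Implicit Arguments.
Unset Strict Implicit.
Unset Printing Implicit Defensive.

Local Open Scope classical_set_scope.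

(* The library's [locally_compact [set: T]] asks for neighbourhoods that are
   compact and closed; here the compact set need not be closed. *)
Definition locally_compact_space (T : topologicalType) : Prop :=
  forall x : T, exists U C : set T,
    [/\ open U, U x, compact C & U `<=` C].

Definition star_open (T : topologicalType) : set_system T :=
  [set A | forall x, A x -> exists U : set T, [/\ regopen U, U x & U `<=` A]].

(* A copy of the carrier of T, equipped below with the topology whose open sets
   are the *-open sets of T; the topology on T itself is left untouched. *)
Definition star_topology (T : topologicalType) : Type := T.

Section StarTopology.
Variable T : topologicalType.
Implicit Types A B : set T.

Lemma regopenI A B : regopen A -> regopen B -> regopen (A `&` B).
Proof.
move=> rA rB.
have oA : open A by rewrite -[A]rA; exact: open_interior.
have oB : open B by rewrite -[B]rB; exact: open_interior.
rewrite /regopen eqEsubset; split; last first.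
  by rewrite -open_subsetE; [exact: subset_closure|exact: openI].
rewrite -[X in _ `<=` X `&` _]rA -[X in _ `<=` _ `&` X]rB -interiorI.
exact/interiorS/closureI.
Qed.

Lemma star_openT : star_open [set: T].
Proof.
by move=> x _; exists setT; split=> //; rewrite /regopen closureT interiorT.
Qed.

Lemma star_openI : setI_closed (@star_open T).
Proof.
move=> A B oA oB x [/oA[U [rU Ux UA]] /oB[V [rV Vx VB]]].
by exists (U `&` V); split; [exact: regopenI|split|exact: setISS].
Qed.

Lemma star_open_bigU (I : Type) (f : I -> set T) :
  (forall i, star_open (f i)) -> star_open (\bigcup_i f i).
Proof.
move=> of_ x [i _ /of_[U [rU Ux Uf]]].
by exists U; split=> // y /Uf fy; exists i.
Qed.

HB.instance Definition _ := Choice.copy (star_topology T) T.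
HB.instance Definition _ := isOpenTopological.Build (star_topology T)
  star_openT star_openI star_open_bigU.

Lemma open_star_topologyE :
  (open : set_system (star_topology T)) = star_open (T := T).
Proof. by []. Qed.

End StarTopology.

(* Main.v *)
(* The *-topology is coarser than the original one, so compact sets stay
   compact. If x lies in an open U inside a compact C, then C is closed since X
   is Hausdorff, so the regular open set int (cl U) lies between U and C. *)
Require Import Defs.
From mathcomp Require Import all_boot all_classical topology.

Local Open Scope classical_set_scope.

Lemma regopen_open (T : topologicalType) (A : set T) : regopen A -> open A.
Proof. by move=> <-; exact: open_interior. Qed.

Lemma regopen_star_open (T : topologicalType) (A : set T) :
  regopen A -> star_open A.
Proof. by move=> rA x Ax; exists A; split. Qed.

(** Each point has a regular open, hence open, neighbourhood inside [A], so it is interior to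
    [A]. *)
Lemma star_open_open (T : topologicalType) (A : set T) : star_open A -> open A.
Proof.
move=> sA; rewrite openE => x /sA[U [/regopen_open oU Ux UA]].
by move: UA; rewrite open_subsetE //; apply.
Qed.

(** [C] is its own image under the identity from [T] to [star_topology T], which is continuous
    because *-open sets are open in [T]. *)
Lemma compact_star_topology (T : topologicalType) (C : set T) :
  compact C -> compact (C : set (star_topology T)).
Proof.
move=> cC; rewrite -[C]image_id.
apply: (@continuous_compact T (star_topology T) id) => //.
apply: continuous_subspaceT; apply/continuousP => A.
exact: star_open_open.
Qed.

Theorem lemma19 (X : topologicalType) :
  hausdorff_space X -> locally_compact_space X ->
  locally_compact_space (star_topology X).
Proof.
move=> hX lX x; have [U [C [oU Ux cC UC]]] := lX x.
have UclU : U `<=` (closure U)° by rewrite -open_subsetE //; exact: subset_closure.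
have clUC : closure U `<=` C.
  by apply: subset_trans (closureS UC) _; exact: compact_closed.
exists (closure U)°, C; split.
(* The interior of any closed set is regular open, here that of [closure U]. *)
- apply: regopen_star_open.
  exact/interior_closed_regopen/closed_closure.
- exact: UclU.
- exact: compact_star_topology.
- exact: subset_trans (@interior_subset _ _) clUC.
Qed.
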